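(* Let $A=\bigoplus_{m\ge0}\mathbb{Z}\,\mathfrak{a}_m$ be the Rota-Baxter ring of weight $0$ described in the context (the free Rota-Baxter $\mathbb{Z}$-algebra on $\mathbb{Z}$ of weight $0$), and let $I$ be a proper nonzero Rota-Baxter ideal of $A$. Then $I$ is prime if and only if $$I=p\mathbb{Z}\,\mathfrak{a}_0\oplus\Big(\bigoplus_{i\ge1}\mathbb{Z}\,\mathfrak{a}_i\Big),$$ where $p$ is either $0$ or a prime number.
   Context: The ring $A$: as an abelian group it is free on the basis $\{\mathfrak{a}_m\mid m\ge 0\}$; the product is the bilinear product determined by $\mathfrak{a}_m\mathfrak{a}_n=\binom{m+n}{m}\mathfrak{a}_{m+n}$ for $m,n\ge0$, with identity $\mathfrak{a}_0$; it carries the additive operator $P$ with $P(\mathfrak{a}_m)=\mathfrak{a}_{m+1}$ for $m\ge 0$. A Rota-Baxter ideal of $A$ is an ideal $I$ of the ring $A$ with $P(I)\subseteq I$. A Rota-Baxter ideal is called prime if it is a prime ideal of the ring $A$ (with $P(I)\subseteq I$). *)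

(* Defs.v *)
From HB Require Import structures.
From mathcomp Require Import all_boot all_order all_algebra.
From mathcomp.multinomials Require Import monalg.
From mathcomp Require Import mathcomp_extra boolp classical_sets.
From mathcomp Require Import finmap ring.

Set Implicit Arguments.
Unset Strict Implicit.
Unset Printing Implicit Defensive.

Import GRing.Theory.
Local Open Scope ring_scope.
Local Open Scope classical_set_scope.

(* {malg int[nat]} is only used as the free abelian group on nat: nat carries
   no monomType structure, so monalg puts no ring structure on it. *)
Definition divpow : Type := {malg int[nat]}.

HB.instance Definition _ := GRing.Zmodule.on divpow.

Definition dpgen (m : nat) : divpow := << 1 *g m >>.

Definition dpmul (x y : divpow) : divpow :=
  \sum_(i <- msupp x) \sum_(j <- msupp y)
    dpgen (i + j) *~ (x@_i * y@_j * 'C(i + j, i)%:Z).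

Definition dpP (x : divpow) : divpow :=
  \sum_(i <- msupp x) dpgen i.+1 *~ x@_i.

Lemma mcoeff_dpgen m (c : int) k : (dpgen m *~ c)@_k = c *+ (m == k).
Proof.
by rewrite (raddfMz (mcoeff k)) /= mcoeffU -mulrzl intz mulr_natr.
Qed.

Lemma dpgen_span (x : divpow) : x = \sum_(i <- msupp x) dpgen i *~ x@_i.
Proof.
rewrite [LHS]monalgE; apply: eq_bigr => i _.
by apply/malgP => k; rewrite mcoeff_dpgen mcoeffU.
Qed.

Lemma dpgen_free n (c : nat -> int) :
  \sum_(i < n) dpgen i *~ c i = 0 -> forall i : 'I_n, c i = 0.
Proof.
move=> s0 i; have := congr1 (mcoeff (i : nat)) s0.
rewrite raddf_sum /= mcoeff0 (bigD1 i) //= mcoeff_dpgen eqxx mulr1n.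
rewrite big1 ?addr0 // => j /negPf ji.
by rewrite mcoeff_dpgen (inj_eq val_inj) ji.
Qed.

(* The ring axioms are transported along the injection into {poly rat} that
   sends the m-th generator to 'X^m / m!, under which dpP is integration. *)
Definition dppoly (x : divpow) : {poly rat} :=
  \sum_(i <- msupp x) ((x@_i)%:~R / (i`!)%:R) *: 'X^i.

Lemma fact_neq0 m : (m`!)%:R != 0 :> rat.
Proof. by rewrite Num.Theory.pnatr_eq0 -lt0n fact_gt0. Qed.

Lemma fact_binV m n :
  ('C(m + n, m))%:~R / ((m + n)`!)%:R = (m`!)%:R^-1 * (n`!)%:R^-1 :> rat.
Proof.
rewrite -(bin_fact (leq_addr n m)) addKn !natrM -pmulrn invfM mulrA divff.
  by rewrite mul1r invfM.
by rewrite Num.Theory.pnatr_eq0 -lt0n bin_gt0 leq_addr.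
Qed.

Lemma coef_dppoly x m : (dppoly x)`_m = (x@_m)%:~R / (m`!)%:R.
Proof.
rewrite /dppoly coef_sum; have [xm|xm] := msuppP x m.
  rewrite (big_fsetD1 m) //= coefZ coefXn eqxx mulr1 big1_fset ?addr0 // => j.
  by rewrite in_fsetD1 coefZ coefXn eq_sym; case: eqP; rewrite ?mulr0.
rewrite mul0r big1_fset // => j xj _; rewrite coefZ coefXn.
by case: eqP xm => [->|_]; rewrite ?xj ?mulr0.
Qed.

Lemma dppoly_is_zmod_morphism : zmod_morphism dppoly.
Proof.
move=> x y; apply/polyP => m.
by rewrite coefB !coef_dppoly mcoeffB rmorphB mulrBl.
Qed.

HB.instance Definition _ :=
  GRing.isZmodMorphism.Build divpow {poly rat} dppoly dppoly_is_zmod_morphism.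

Lemma dppoly_inj : injective dppoly.
Proof.
move=> x y /polyP xy; apply/malgP => m; have := xy m.
rewrite !coef_dppoly => /(mulIf (invr_neq0 (fact_neq0 m))).
exact: intr_inj.
Qed.

Lemma dppoly_gen m c : dppoly (dpgen m *~ c) = (c%:~R / (m`!)%:R) *: 'X^m.
Proof.
apply/polyP => k; rewrite coef_dppoly mcoeff_dpgen coefZ coefXn eq_sym.
by case: eqP => [->|_]; rewrite ?mulr1 ?mulr0 ?mul0r.
Qed.

Lemma dppolyM x y : dppoly (dpmul x y) = dppoly x * dppoly y.
Proof.
rewrite raddf_sum mulr_suml; apply: eq_bigr => i _.
rewrite raddf_sum mulr_sumr; apply: eq_bigr => j _ /=.
rewrite dppoly_gen -scalerAl -scalerAr scalerA -exprD; congr (_ *: _).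
by rewrite !rmorphM /= -mulrA fact_binV; ring.
Qed.

Lemma dppoly1 : dppoly (dpgen 0) = 1.
Proof. by have := dppoly_gen 0 1; rewrite mulr1z divr1 scale1r expr0. Qed.

Fact dpmulA : associative dpmul.
Proof. by move=> x y z; apply: dppoly_inj; rewrite !dppolyM mulrA. Qed.

Fact dpmulC : commutative dpmul.
Proof. by move=> x y; apply: dppoly_inj; rewrite !dppolyM mulrC. Qed.

Fact dpmul1 : left_id (dpgen 0) dpmul.
Proof. by move=> x; apply: dppoly_inj; rewrite dppolyM dppoly1 mul1r. Qed.

Fact dpmulDl : left_distributive dpmul +%R.
Proof.
move=> x y z; apply: dppoly_inj.
by rewrite [RHS]raddfD /= !dppolyM raddfD mulrDl.
Qed.

Fact dp1_neq0 : dpgen 0 != 0.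
Proof. by rewrite monalgU_eq0. Qed.

HB.instance Definition _ := GRing.Zmodule_isComNzRing.Build divpow
  dpmulA dpmulC dpmul1 dpmulDl dp1_neq0.

Lemma dpgenM m n : dpgen m * dpgen n = dpgen (m + n) *+ 'C(m + n, m).
Proof.
apply: dppoly_inj; apply: etrans (dppolyM _ _) _.
rewrite -[dpgen m]mulr1z -[dpgen n]mulr1z pmulrn !dppoly_gen.
by rewrite -scalerAl -scalerAr scalerA -exprD fact_binV; congr (_ *: _); ring.
Qed.

Lemma dppoly_P x k : (dppoly (dpP x))`_k =
  if k is k'.+1 then (dppoly x)`_k' / k%:R else 0.
Proof.
rewrite /dpP raddf_sum /= coef_sum; case: k => [|k].
  by apply: big1 => i _; rewrite /= dppoly_gen coefZ coefXn mulr0.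
rewrite [dppoly x]/dppoly coef_sum mulr_suml; apply: eq_bigr => i _.
rewrite /= dppoly_gen !coefZ !coefXn eqSS; case: eqP => [->|_].
  by rewrite !mulr1 factS natrM invfM mulrA mulrAC.
by rewrite !mulr0 mul0r.
Qed.

Fact dpP_is_zmod_morphism : zmod_morphism dpP.
Proof.
move=> x y; apply: dppoly_inj; apply/polyP => -[|k].
  by rewrite raddfB coefB !dppoly_P subr0.
by rewrite raddfB coefB !dppoly_P raddfB coefB mulrBl.
Qed.

HB.instance Definition _ :=
  GRing.isZmodMorphism.Build divpow divpow dpP dpP_is_zmod_morphism.

Lemma dpP_gen m : dpP (dpgen m) = dpgen m.+1.
Proof.
by rewrite /dpP /dpgen msuppU big_seq_fset1 mcoeffUU mulr1z.
Qed.

Lemma dpP_rota_baxter x y : dpP x * dpP y = dpP (x * dpP y) + dpP (dpP x * y).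
Proof.
have dP z : (dppoly (dpP z))^`() = dppoly z.
  apply/polyP => k; rewrite coef_deriv dppoly_P -[LHS]mulr_natr divfK //.
  by rewrite Num.Theory.pnatr_eq0.
apply: dppoly_inj; rewrite raddfD; apply/polyP => -[|k].
  by rewrite dppolyM coef0M coefD !dppoly_P mul0r addr0.
have /polyP/(_ k) : (dppoly (dpP x * dpP y))^`() =
    (dppoly (dpP (x * dpP y)) + dppoly (dpP (dpP x * y)))^`().
  by rewrite derivD !dP !dppolyM derivM !dP.
rewrite !coef_deriv => /eqP; rewrite -subr_eq0 -mulrnBl.
by rewrite Num.Theory.mulrn_eq0 subr_eq0 /= => /eqP.
Qed.

(* idealr_closed of ring_quotient has properness built in. *)
Definition ideal (R : comNzRingType) (I : set R) : Prop :=
  [/\ I 0, forall x y, I x -> I y -> I (x + y)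
    & forall r x, I x -> I (r * x)].

Definition prime_ideal (R : comNzRingType) (I : set R) : Prop :=
  [/\ ideal I, I <> setT & prime_idealr_closed [in I]].

Definition rota_baxter_ideal (I : set divpow) : Prop :=
  ideal I /\ dpP @` I `<=` I.

Definition rota_baxter_prime (I : set divpow) : Prop :=
  rota_baxter_ideal I /\ prime_ideal I.

(* Main.v *)
(** For x with coefficients x_i, the element (d+1) P(x) - a_1 x has coefficient
    (d - i) x_i on a_{i+1}: the term of index d is killed and the others
    survive. Iterating, a nonzero Rota-Baxter ideal contains some c a_n with
    c <> 0, hence also a_1^N = N! a_N as soon as N >= n and c divides N!. So a
    prime one contains a_1, hence all a_i with i >= 1, and it is determined by
    its constant coefficients, which form a prime ideal of the integers. *)
Require Import Defs.
From mathcomp Require Import all_boot all_order all_algebra.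
From mathcomp Require Import boolp classical_sets.
From mathcomp.multinomials Require Import monalg.
From mathcomp Require Import finmap ring zify.

Import GRing.Theory Num.Theory.

Local Open Scope ring_scope.
Local Open Scope classical_set_scope.

(** Both sides are compared in [rat] after division by k!, where [dppoly] turns [dpP] into
    integration. *)
Lemma mcoeff_dpP (x : divpow) k : (dpP x)@_k = if k is j.+1 then x@_j else 0.
Proof.
apply: (@intr_inj rat); apply: (mulIf (invr_neq0 (fact_neq0 k))).
rewrite -coef_dppoly dppoly_P; case: k => [|k]; first by rewrite mul0r.
by rewrite coef_dppoly factS natrM invfM mulrA mulrAC.
Qed.

(** [dppoly] sends [dpgen 1] to 'X, which shifts coefficients; the factor [k] is the quotient of k!
    by (k-1)!. *)
Lemma mcoeff_dpgen1M (x : divpow) k :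
  (dpgen 1 * x)@_k = if k is j.+1 then x@_j *+ k else 0.
Proof.
apply: (@intr_inj rat); apply: (mulIf (invr_neq0 (fact_neq0 k))).
rewrite -coef_dppoly dppolyM -[dpgen 1]mulr1z dppoly_gen divr1 scale1r coefXM.
case: k => [|k]; first by rewrite mul0r.
rewrite coef_dppoly factS natrM rmorphMn /= -mulr_natr.
by field; rewrite fact_neq0 nat1r pnatr_eq0.
Qed.

(** This multiplicativity transfers primality from the integers to the ring. *)
Lemma mcoeff0M (x y : divpow) : (x * y)@_0%N = x@_0%N * y@_0%N.
Proof.
apply: (@intr_inj rat); rewrite rmorphM /=.
have e (z : divpow) : (z@_0%N)%:~R = (dppoly z)`_0 by rewrite coef_dppoly divr1.
by rewrite !e dppolyM coef0M.
Qed.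

Lemma dpgen1X n : dpgen 1 ^+ n = dpgen n *+ n`!.
Proof.
elim: n => [|n IHn]; first by rewrite expr0.
by rewrite exprS IHn mulrnAr dpgenM add1n bin1 -mulrnA -factS.
Qed.

Lemma dpPn_gen k n (c : int) : iter k dpP (dpgen n *~ c) = dpgen (n + k) *~ c.
Proof.
elim: k => [|k IHk]; first by rewrite addn0.
by rewrite iterS IHk raddfMz /= dpP_gen addnS.
Qed.

Lemma mcoeff_sum_dpgen m n (c : nat -> int) k :
  (\sum_(m <= i < n) dpgen i *~ c i)@_k = if (m <= k < n)%N then c k else 0.
Proof.
rewrite raddf_sum /= (eq_bigr (fun i => if i == k then c i else 0)).
  by rewrite -big_mkcond big_nat1_eq.
by move=> i _; rewrite mcoeff_dpgen; case: eqP.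
Qed.

Lemma msupp_bounded (x : divpow) : exists d, forall k, x@_k != 0 -> (k <= d)%N.
Proof.
exists (\max_(i <- msupp x) i) => k.
by case: msuppP => [kx _|]; [apply: (leq_bigmax_seq (F := id))|rewrite eqxx].
Qed.

Lemma dpgen_decomp (x : divpow) : exists n,
  x = dpgen 0 *~ x@_0%N + \sum_(1 <= i < n) dpgen i *~ x@_i.
Proof.
have [d xd] := msupp_bounded x; exists d.+1.
apply/malgP => k; rewrite mcoeffD mcoeff_dpgen mcoeff_sum_dpgen.
case: k => [|k] /=; first by rewrite addr0.
rewrite add0r ltnS; case: ifP => // kd.
by apply/eqP/negPn/negP => /xd; rewrite kd.
Qed.

(** Replaces membership in the explicit direct sum by a divisibility test, since the higher
    coefficients are arbitrary. *)
Lemma const_coef_setP (p : nat) (x : divpow) :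
  (exists (k : int) (n : nat) (c : nat -> int),
     x = dpgen 0 *~ (p%:Z * k) + \sum_(1 <= i < n) dpgen i *~ c i) <->
  (p %| x@_0%N)%Z.
Proof.
split=> [[k [n [c ->]]]|/dvdzP[k xk]].
  by rewrite mcoeffD mcoeff_dpgen mcoeff_sum_dpgen addr0 dvdz_mulr.
have [n xE] := dpgen_decomp x; exists k, n, (fun i => x@_i).
by rewrite mulrC -xk.
Qed.

Lemma prime_dvdzM (p : nat) (a b : int) :
  prime p -> (p %| a * b)%Z = (p %| a)%Z || (p %| b)%Z.
Proof. by move=> p_prime; rewrite !dvdzE abszM Euclid_dvdM. Qed.

Section Ideal.

Variables (R : comNzRingType) (I : set R).
Hypothesis I_ideal : ideal I.

Lemma ideal_mulrz x (c : int) : I x -> I (x *~ c).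
Proof. by case: I_ideal => _ _ IM Ix; rewrite -mulrzl; apply: IM. Qed.

Lemma ideal_sub x y : I x -> I y -> I (x - y).
Proof.
by case: I_ideal => _ ID IM Ix Iy; apply: ID => //; rewrite -mulN1r; apply: IM.
Qed.

Lemma ideal_sum (J : Type) (r : seq J) (P : pred J) (F : J -> R) :
  (forall i, P i -> I (F i)) -> I (\sum_(i <- r | P i) F i).
Proof. by case: I_ideal => I0 ID _ IF; apply: big_ind. Qed.

Lemma ideal_1_eqT : I 1 -> I = setT.
Proof.
case: I_ideal => _ _ IM I1; apply/seteqP; split=> // x _.
by rewrite -[x]mulr1; apply: IM.
Qed.

End Ideal.

Lemma prime_idealM (R : comNzRingType) (I : set R) x y :
  prime_ideal I -> I (x * y) -> I x \/ I y.
Proof.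
by case=> _ _ Ipr Ixy; have := Ipr x y; rewrite !in_setE;
  move=> /(_ Ixy) /orP[] /asboolP; [left|right].
Qed.

Lemma prime_idealX (R : comNzRingType) (I : set R) x n :
  prime_ideal I -> I (x ^+ n) -> I x.
Proof.
move=> Ipr; elim: n => [|n IHn]; last first.
  by rewrite exprS => /(prime_idealM _ _ _ _ Ipr)[].
(* Exponent 0 would put 1 in [I], against properness. *)
by rewrite expr0; case: Ipr => Iid IT _ /(ideal_1_eqT _ _ Iid).
Qed.

Lemma rota_baxter_ideal_monomial {I : set divpow} {x : divpow} :
  rota_baxter_ideal I -> I x -> x != 0 ->
  exists n (c : int), c != 0 /\ I (dpgen n *~ c).
Proof.
move=> [Iid IP] Ix /eqP x_neq0.
have xN0 : exists m, x@_m != 0.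
  apply: contrapT => xN; apply: x_neq0; apply/malgP => k; rewrite mcoeff0.
  by apply/eqP/negPn/negP => xk; apply: xN; exists k.
case: (ex_minnP xN0) => m xm m_min.
have [d xd] := msupp_bounded x.
have {}xd k : x@_k != 0 -> (m <= k <= m + d)%N.
  by move=> xk; have := xd _ xk; have := m_min _ xk; lia.
(* Induction on the width [d] of a window of indices that starts at a nonzero coefficient and
   contains the support. *)
elim: d m x Ix xm xd {x_neq0 xN0 m_min} => [|d IHd] m x Ix xm xd.
  exists m, x@_m; split=> //; suff <- : x = dpgen m *~ x@_m by [].
  apply/malgP => k; rewrite mcoeff_dpgen; case: eqP => [<- //|mk].
  by apply/eqP/negPn/negP => /xd; lia.
(* The top index is now m+d+1, whence the multiplier m+d+2. The new window runs from m+1 to m+1+d,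
   and its first coefficient is (d+1) times that of [x] at [m]. *)
pose y : divpow := dpP x *+ (m + d).+2 - dpgen 1 * x.
have ySE j : y@_j.+1 = x@_j *+ (m + d).+2 - x@_j *+ j.+1.
  by rewrite mcoeffB mcoeffMn mcoeff_dpP mcoeff_dpgen1M.
apply: (IHd m.+1 y).
- apply: ideal_sub => //; last by case: Iid => _ _; apply.
  by rewrite pmulrn; apply: ideal_mulrz => //; apply: IP; exists x.
- rewrite ySE -mulrnBr; last lia.
  by rewrite mulrn_eq0 (negPf xm) orbF; lia.
- case=> [|j].
    by rewrite mcoeffB mcoeffMn mcoeff_dpP mcoeff_dpgen1M mul0rn subrr.
  rewrite ySE; have [->|/xd] := eqVneq x@_j 0; first by rewrite !mul0rn subrr.
  have [->|] := eqVneq j (m + d).+1; first by rewrite subrr.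
  by lia.
Qed.

Lemma rota_baxter_prime_dpgen (I : set divpow) i :
  rota_baxter_prime I -> I <> [set 0] -> I (dpgen i.+1).
Proof.
move=> [[Iid IP] Ipr] IN0.
have [x Ix x_neq0] : exists2 x, I x & x != 0.
  apply: contrapT => xN; apply: IN0; apply/seteqP; split=> [x Ix|_ ->].
    by apply/eqP/negPn/negP => x_neq0; apply: xN; exists x.
  by case: Iid.
have [n [c [c_neq0 Ic]]] := rota_baxter_ideal_monomial (conj Iid IP) Ix x_neq0.
have iterP k z : I z -> I (iter k dpP z).
  by move=> Iz; elim: k => //= k Ik; apply: IP; exists (iter k dpP z).
(* Large enough both to reach index [N] from [n] by iterating [dpP] and to make [c] divide N!. *)
pose N := (n + `|c|)%N.
have /dvdzP[q qE] : (c %| (N`!)%:Z)%Z.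
  rewrite dvdzE /= dvdn_fact // absz_gt0 c_neq0 /=.
  by rewrite /N leq_addl.
have I1 : I (dpgen 1).
  apply: (prime_idealX _ _ _ N Ipr); rewrite dpgen1X pmulrn qE mulrC mulrzA.
  by apply: ideal_mulrz => //; rewrite -dpPn_gen; apply: iterP.
by have := iterP i _ I1; rewrite -[dpgen 1]mulr1z dpPn_gen mulr1z add1n.
Qed.

Theorem theorem4p3 (I : set divpow) (I_ideal : rota_baxter_ideal I)
    (I_proper : I <> setT) (I_neq0 : I <> [set 0]) :
  rota_baxter_prime I <->
  exists2 p : nat, p = 0%N \/ prime p &
    I = [set x | exists (k : int) (n : nat) (c : nat -> int),
           x = dpgen 0 *~ (p%:Z * k) + \sum_(1 <= i < n) dpgen i *~ c i].
Proof.
split=> [Irbp|[p p_prime IE]]; last first.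
  (* Primality of [I] thus becomes primality of [p] (or absence of zero divisors, if [p] is 0) on
     constant coefficients. *)
  have IP x : I x <-> (p %| x@_0%N)%Z by rewrite IE; apply: const_coef_setP.
  split=> //; split=> //; first by case: I_ideal.
  move=> x y; rewrite !in_setE => /IP; rewrite mcoeff0M => pxy.
  suff /orP[/IP Ix|/IP Iy] : (p %| x@_0%N)%Z || (p %| y@_0%N)%Z.
  - by apply/orP; left; apply/asboolP.
  - by apply/orP; right; apply/asboolP.
  case: p_prime pxy => [->|p_prime]; last by rewrite prime_dvdzM.
  by rewrite !dvd0z mulf_eq0.
have [[Iid _] Ipr] := Irbp.
(* [x] differs from its constant term by a combination [t] of generators of positive index, all in
   [I]. *)
have constP x : I x <-> I (dpgen 0 *~ x@_0%N).
  have [n xE] := dpgen_decomp x; set t := bigop _ _ _ in xE.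
  have It : I t.
    rewrite /t big_add1; apply: ideal_sum => // i _.
    by apply: ideal_mulrz => //; apply: rota_baxter_prime_dpgen.
  split=> Ix.
    by rewrite -[_ *~ _](addrK t) -xE; apply: ideal_sub.
  by rewrite xE; case: Iid => _ ID _; apply: ID.
suff [p p_prime pP] : exists2 p : nat, p = 0%N \/ prime p &
    forall c : int, I (dpgen 0 *~ c) <-> (p %| c)%Z.
  exists p => //; apply/seteqP; split=> x.
    by move=> /constP/pP ?; apply/const_coef_setP.
  by move=> /const_coef_setP/pP Ix; apply/constP.
have I1 : ~ I (dpgen 0) by move/(ideal_1_eqT _ _ Iid).
(* [p] is the least positive integer whose multiple of the identity lies in [I], or 0 if there is
   none. *)
have [I_pos|I_pos] := pselect
    (exists k : nat, (0 < k)%N && `[< I (dpgen 0 *~ k%:Z) >]); last first.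
  exists 0%N => [|c]; first by left.
  rewrite dvd0z; split=> [Ic|/eqP ->]; last by case: Iid.
  apply/negPn/negP => c_neq0; apply: I_pos; exists `|c|%N.
  rewrite absz_gt0 c_neq0; apply/asboolP.
  by rewrite abszEsg mulrC mulrzA; apply: ideal_mulrz.
case: (ex_minnP I_pos) => p /andP[p_gt0 /asboolP Ip] p_min.
have pP (c : int) : I (dpgen 0 *~ c) <-> (p %| c)%Z.
  split=> [Ic|/dvdzP[q ->]]; last first.
    by rewrite mulrC mulrzA; apply: ideal_mulrz.
  (* The Euclidean remainder also lies in [I], so minimality of [p] forces it to vanish. *)
  have Ir : I (dpgen 0 *~ (c %% p)%Z).
    rewrite /modz mulrzBr; apply: ideal_sub => //.
    by rewrite mulrC mulrzA; apply: ideal_mulrz.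
  apply/dvdz_mod0P; have p_neq0 : p%:Z != 0 by lia.
  have r_ge0 := modz_ge0 c p_neq0; have r_lt : (c %% p)%Z < p by apply: ltz_pmod.
  apply/eqP/negPn/negP => r_neq0.
  have := p_min `|(c %% p)%Z|%N; rewrite gez0_abs //.
  by rewrite absz_gt0 r_neq0 (asboolT Ir) => /(_ isT); lia.
exists p => //; right; apply/primeP; split.
  rewrite ltn_neqAle p_gt0 andbT; apply/eqP => p1.
  by apply: I1; rewrite -p1 in Ip.
move=> a /dvdnP[b pE].
(* With p = b a, primality of [I] makes [p] divide one of its own factors: [b], giving a = 1, or
   [a], giving a = p. *)
have : I ((dpgen 0 *~ b%:Z) * (dpgen 0 *~ a%:Z)).
  by rewrite mulrzAl mulrzAr mul1r -mulrzA mulrC -PoszM -pE.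
move=> /(prime_idealM _ _ _ _ Ipr)[] /pP; rewrite dvdzE /= => p_dvd.
  have bp : b = p by apply/eqP; rewrite eqn_dvd p_dvd pE dvdn_mulr.
  by rewrite -(eqn_pmul2l p_gt0) muln1 -{1}bp -pE eqxx.
by rewrite [a == p]eqn_dvd p_dvd pE dvdn_mull ?orbT.
Qed.
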